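(* In the star graph probing problem with a random, unknown patience, the competitive ratio against a benchmark that knows the realization of the patience in advance is $o(1)$: for every $\epsilon>0$ there is an instance (star graph with weights and probabilities, and a patience distribution) in which the maximum expected reward of any probing policy that does not know the realized patience is at most $\epsilon$ times the expected reward of an optimal policy that knows the realized patience before probing.
   Context: Star graph probing problem: a single online vertex $v$ and offline vertices $u$ with weights $w_{uv}\ge0$ and success probabilities $p_{uv}\in[0,1]$. The patience of $v$ is a random positive integer $\Theta$ with known distribution. A policy adaptively probes offline vertices, each at most once; a probe of $u$ succeeds independently with probability $p_{uv}$, in which case reward $w_{uv}$ is collected and the process stops; after $\Theta$ failed probes the process stops. A non-clairvoyant policy does not know $\Theta$ in advance (it learns only that patience has been exhausted when it happens); the clairvoyant benchmark chooses its probing strategy after observing the realized value of $\Theta$. *)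

(* Defs.v *)
From HB Require Import structures.
From mathcomp Require Import all_boot all_order all_algebra.
From mathcomp Require Import all_classical all_reals all_analysis.

Set Implicit Arguments.
Unset Strict Implicit.
Unset Printing Implicit Defensive.

Import Order.TTheory GRing.Theory Num.Theory.
Local Open Scope ring_scope.

(* The online vertex is implicit. [patience k] is the probability that the
   patience equals k; its support may be infinite. *)
Record star (R : realType) := Star {
  offline :> finType;
  weight : offline -> R;
  prob : offline -> R;
  patience : nat -> R;
  weight_ge0 : forall u, 0 <= weight u;
  prob_itv : forall u, 0 <= prob u <= 1;
  patience_ge0 : forall k, 0 <= patience k;
  patience0 : patience 0%N = 0;
  patience_sum : (\sum_(0 <= k <oo) (patience k)%:E = 1)%E
}.

(* Probing ends at the first success and when the patience is exhausted, so
   whenever a decision is made the observed history is exactly the sequence of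
   vertices probed so far, all of them having failed. [probe s h] is the next
   vertex, or [None] to stop voluntarily. The seed s, drawn from [seed_law]
   independently of everything else, lets policies be randomized. *)
Record policy (R : realType) (U : finType) := Policy {
  seed : finType;
  seed_law : seed -> R;
  probe : seed -> seq U -> option U;
  seed_law_ge0 : forall s, 0 <= seed_law s;
  seed_law_sum : \sum_s seed_law s = 1;
  probe_once : forall s h u, probe s h = Some u -> u \notin h
}.

Section StarProbing.
Variables (R : realType) (I : star R).

(* [x u] tells whether a probe of u would succeed. *)
Definition outcome_law (x : {ffun I -> bool}) : R :=
  \prod_u (if x u then prob u else 1 - prob u).

(* The reward collected from history h on, when next probes are given by f,
   k more probes are allowed and the outcomes are x. *)
Fixpoint run (f : seq I -> option I) (x : {ffun I -> bool}) (k : nat)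
    (h : seq I) : R :=
  if k is k'.+1 then
    if f h is Some u then
      if x u then weight u else run f x k' (rcons h u)
    else 0
  else 0.

Definition reward_given (pi : policy R I) (k : nat) : R :=
  \sum_s seed_law s * \sum_x outcome_law x * run (@probe R I pi s) x k [::].

(* A clairvoyant policy selects a policy [sigma k] after observing that the
   patience is k; a non-clairvoyant one is a constant family. The terms of the
   series are nonnegative. *)
Definition expected_reward (sigma : nat -> policy R I) : \bar R :=
  (\sum_(0 <= k <oo) (patience I k * reward_given (sigma k) k)%:E)%E.

Definition optimal_nonclairvoyant (pi : policy R I) : Prop :=
  forall pi' : policy R I,
    (expected_reward (fun=> pi') <= expected_reward (fun=> pi))%E.

Definition optimal_clairvoyant (sigma : nat -> policy R I) : Prop :=
  forall sigma' : nat -> policy R I,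
    (expected_reward sigma' <= expected_reward sigma)%E.

End StarProbing.

(* Main.v *)
Require Import Defs.
From HB Require Import structures.
From mathcomp Require Import all_boot all_order all_algebra.
From mathcomp Require Import all_classical all_reals all_analysis.
From mathcomp Require Import ring lra.

Set Implicit Arguments.
Unset Strict Implicit.
Unset Printing Implicit Defensive.

Import Order.TTheory GRing.Theory Num.Theory.
Local Open Scope ring_scope.

(* The instance has levels j < m. With N = 2 ^ m, level j is the event, of
   probability about 2 ^- j, that the patience is N ^ (j + 1), and comes with at
   least that many vertices of weight 2 ^ j and probability N ^- (j + 1). Knowing
   the level, one probes only its vertices and succeeds with probability at
   least 1/2, so that each level contributes at least 1/4, in total m / 4.

   Without that knowledge, a probe at level j is either early, at a time which
   the patience of level j - 1 already covers, and then too unlikely to succeed: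
   all early probes together are worth at most 1; or late, and then the patience
   lasts with probability at most 2 ^- j, so that it is worth at most its
   probability of success. As the process stops at the first success, all late
   probes together are worth at most 1.

   Optimal policies exist because the value of a deterministic rule depends only
   on its restriction to repetition-free histories, of which there are finitely
   many, and a randomized policy is a mixture of deterministic rules. *)

(** * Values of deterministic rules *)

Section DeterministicRules.
Variables (R : realType) (I : star R).
Implicit Types (f g : seq I -> option I) (h : seq I) (u : I).

Definition once f := forall h u, f h = Some u -> u \notin h.

(** For a rule satisfying [once], this is the expectation of [run], computed by conditioning on the
    next probe. *)
Fixpoint rule_value f (k : nat) h : R :=
  if k is k'.+1 then
    if f h is Some u then
      prob u * weight u + (1 - prob u) * rule_value f k' (rcons h u)
    else 0
  else 0.

Lemma rule_value_None f k h : f h = None -> rule_value f k h = 0.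
Proof. by case: k => //= k ->. Qed.

Lemma rule_value_ge0 f k h : 0 <= rule_value f k h.
Proof.
elim: k h => //= k IH h; case: (f h) => // u.
have /andP[p0 p1] := prob_itv u.
by rewrite addr_ge0 ?mulr_ge0 ?weight_ge0 ?subr_ge0.
Qed.

Lemma eq_rule_value f g :
  once g -> {in uniq, f =1 g} ->
  forall k h, uniq h -> rule_value f k h = rule_value g k h.
Proof.
move=> og fg; elim=> //= k IH h uh; rewrite fg //.
case E: (g h) => [u|//]; rewrite IH //.
by rewrite rcons_uniq uh andbT; exact: og E.
Qed.

(* Generalized to signed product weights [a], which need to be the probing law
   only at the vertices not yet probed: conditioning on the outcome at [u]
   amounts to zeroing one of the two weights at [u]. *)
Lemma sum_run f : once f -> forall k h (a : I -> bool -> R),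
  (forall v, v \notin h -> a v = fun b => if b then prob v else 1 - prob v) ->
  \sum_(x : {ffun I -> bool}) (\prod_v a v (x v)) * run f x k h =
  rule_value f k h * \prod_v (a v true + a v false).
Proof.
move=> of_; elim=> [|k IH] h a ha /=.
  by rewrite mul0r big1 // => x _; rewrite mulr0.
case E: (f h) => [u|]; last by rewrite mul0r big1 // => x _; rewrite mulr0.
have au := ha _ (of_ _ _ E).
pose restr c v b := if (v == u) && (b != c) then 0 else a v b.
have prod_restr c (x : {ffun I -> bool}) :
    \prod_v restr c v (x v) = if x u == c then \prod_v a v (x v) else 0.
  case: eqP => [xu|/eqP xu].
    apply: eq_bigr => v _; rewrite /restr; case: eqP => //= ->.
    by rewrite xu eqxx.
  by rewrite (bigD1 u) //= /restr eqxx xu mul0r.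
pose P := \prod_(v | v != u) (a v true + a v false).
have tot c : \prod_v (restr c v true + restr c v false) = a u c * P.
  rewrite (bigD1 u) //=; congr (_ * _).
    by rewrite /restr eqxx; case: c => /=; rewrite ?addr0 ?add0r.
  by apply: eq_bigr => v vu; rewrite /restr (negPf vu).
rewrite (bigD1 u) //= -/P.
have -> : a u true + a u false = 1 by rewrite au addrC subrK.
(* A success at [u] earns [weight u] whatever the other outcomes; after a failure the induction
   hypothesis applies to [restr false]. *)
transitivity (weight u * (\sum_(x : {ffun I -> bool}) \prod_v restr true v (x v))
  + \sum_(x : {ffun I -> bool}) (\prod_v restr false v (x v)) * run f x k (rcons h u)).
  rewrite mulr_sumr -big_split /=; apply: eq_bigr => x _; rewrite !prod_restr.
  by case: (x u) => /=; rewrite ?mul0r ?mulr0 ?addr0 ?add0r // mulrC.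
rewrite IH; last first.
  move=> v; rewrite mem_rcons inE negb_or => /andP[vu vh].
  by apply: funext => b; rewrite /restr (negPf vu) ha.
rewrite -(bigA_distr_bigA (fun v b => restr true v b)).
under eq_bigr do rewrite big_bool /=.
by rewrite !tot au /=; ring.
Qed.

Lemma reward_givenE (pi : policy R I) k :
  reward_given pi k =
  \sum_s seed_law s * rule_value (@probe R I pi s) k [::].
Proof.
apply: eq_bigr => s _; congr (_ * _).
have os : once (@probe R I pi s) by move=> h u; exact: probe_once.
rewrite (sum_run os k (h := [::]) (a := fun v b => if b then prob v else 1 - prob v)) //.
by rewrite big1 ?mulr1 // => v _; rewrite addrC subrK.
Qed.

Lemma reward_given_ge0 (pi : policy R I) k : 0 <= reward_given pi k.
Proof.
rewrite reward_givenE sumr_ge0 // => s _.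
by rewrite mulr_ge0 ?seed_law_ge0 ?rule_value_ge0.
Qed.

Lemma reward_given_le (pi : policy R I) k (c : R) :
  (forall f, once f -> rule_value f k [::] <= c) -> reward_given pi k <= c.
Proof.
move=> hc; rewrite reward_givenE -[c]mul1r -(seed_law_sum pi) mulr_suml.
apply: ler_sum => s _; rewrite ler_wpM2l ?seed_law_ge0 //.
by apply: hc => h u; exact: probe_once.
Qed.

(** * Finite encoding of rules and existence of optimal policies *)

Definition guard f h := obind (fun u => if u \in h then None else Some u) (f h).

Lemma guard_once f : once (guard f).
Proof. by move=> h u; rewrite /guard; case: (f h) => //= v; case: ifPn => // + [<-]. Qed.

Lemma guard_id f h : once f -> guard f h = f h.
Proof.
rewrite /guard => of_; case E: (f h) => [u|//] /=.
by rewrite (negPf (of_ _ _ E)).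
Qed.

Lemma unit_law_sum : \sum_(s : unit) (1 : R) = 1.
Proof. by rewrite (big_pred1 tt) // => -[]. Qed.

Definition rule_policy f : policy R I :=
  Policy (fun _ : unit => ler01) unit_law_sum (fun _ => @guard_once f).

Lemma reward_given_rule f k :
  reward_given (rule_policy f) k = rule_value (guard f) k [::].
Proof. by rewrite reward_givenE (big_pred1 tt) /= ?mul1r // => -[]. Qed.

(** A repetition-free history has at most [#|I|] entries, so bounded sequences suffice and the codes
    form a finite type. *)
Definition rule_code : finType := {ffun #|I|.-bseq I -> option I}.

Definition decode (c : rule_code) h : option I := obind c (insub h).

Lemma decode_surj f : once f ->
  exists c : rule_code, forall k,
    rule_value f k [::] = rule_value (guard (decode c)) k [::].
Proof.
move=> of_; exists [ffun b => f (val b)] => k.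
apply: eq_rule_value => //; first exact: guard_once.
move=> h uh; rewrite -[LHS]guard_id // /guard /decode insubT //.
  by rewrite -(card_uniqP uh) max_card.
by move=> hs /=; rewrite ffunE.
Qed.

Lemma clairvoyant_pointwise_optimum :
  exists sigma : nat -> policy R I, forall k (pi : policy R I),
    reward_given pi k <= reward_given (sigma k) k.
Proof.
pose F k (c : rule_code) := rule_value (guard (decode c)) k [::].
pose best k := [arg max_(c > [ffun=> None] : rule_code) F k c]%O.
exists (fun k => rule_policy (decode (best k))) => k pi.
rewrite reward_given_rule; apply: reward_given_le => f /decode_surj[c ->].
by rewrite /best; case: arg_maxP => // c' _ /(_ c isT).
Qed.

Lemma pointwise_optimal_clairvoyant (sigma : nat -> policy R I) :
  (forall k (pi : policy R I),
    reward_given pi k <= reward_given (sigma k) k) ->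
  optimal_clairvoyant sigma.
Proof.
move=> opt sigma'; apply: lee_nneseries => [k _ _|k _]; rewrite lee_fin.
  by rewrite mulr_ge0 ?patience_ge0 ?reward_given_ge0.
by rewrite ler_wpM2l ?patience_ge0.
Qed.

(** The expected reward is the [seed_law]-average of the values [V] of deterministic rules, hence at
    most the largest [V] over the finitely many codes. *)
Lemma nonclairvoyant_optimum :
  exists pi : policy R I, optimal_nonclairvoyant pi.
Proof.
pose V f : \bar R :=
  (\sum_(0 <= k <oo) (patience I k * rule_value f k [::])%:E)%E.
have term_ge0 f k : (0 <= (patience I k * rule_value f k [::])%:E)%E.
  by rewrite lee_fin mulr_ge0 ?patience_ge0 ?rule_value_ge0.
have V_ge0 f : (0 <= V f)%E by apply: nneseries_ge0.
have VE (pi : policy R I) : expected_reward (fun=> pi) =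
    (\sum_(s : seed pi) (seed_law s)%:E * V (@probe R I pi s))%E.
  transitivity (\sum_(0 <= k <oo) \sum_(s : seed pi) (seed_law s)%:E *
      (patience I k * rule_value (@probe R I pi s) k [::])%:E)%E.
    apply: eq_eseriesr => k _; rewrite reward_givenE mulr_sumr sumEFin.
    by congr (_%:E); apply: eq_bigr => s _; rewrite mulrCA.
  rewrite nneseries_sum.
    by apply: eq_bigr => s _; rewrite nneseriesZl.
  by move=> s k _; rewrite mule_ge0 // lee_fin seed_law_ge0.
pose F (c : rule_code) := V (guard (decode c)).
pose best := [arg max_(c > [ffun=> None] : rule_code) F c]%O.
exists (rule_policy (decode best)) => pi; rewrite !VE /=.
rewrite [leRHS](big_pred1 tt) /= ?mul1e; last by case.
rewrite -[leRHS]mul1e -(seed_law_sum pi) -sumEFin ge0_sume_distrl; last first.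
  by move=> s _; rewrite lee_fin seed_law_ge0.
apply: lee_sum => s _; apply: lee_wpmul2l; first by rewrite lee_fin seed_law_ge0.
have [c Ec] : exists c : rule_code, V (@probe R I pi s) = F c.
  have [c Ec] := @decode_surj (@probe R I pi s) (@probe_once _ _ _ _).
  by exists c; apply: eq_eseriesr => k _; rewrite Ec.
by rewrite Ec /best; case: arg_maxP => // c' _ /(_ c isT).
Qed.

End DeterministicRules.

(** After exchanging the sums, the series for [j] has a single nonzero term, at [n j]. *)
Lemma nneseries_mixture (R : realType) (m : nat) (q : nat -> R)
    (n : nat -> nat) (f : nat -> R) :
  (forall j, 0 <= q j) -> (forall k, 0 <= f k) ->
  (\sum_(0 <= k <oo) ((\sum_(j < m) q j * (k == n j)%:R) * f k)%:E =
   (\sum_(j < m) q j * f (n j))%:E)%E.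
Proof.
move=> q0 f0; pose g (j : 'I_m) k := (q j * (k == n j)%:R * f k)%:E.
have g0 j k : (0 <= g j k)%E by rewrite lee_fin !mulr_ge0.
transitivity (\sum_(0 <= k <oo) \sum_(j < m) g j k)%E.
  by apply: eq_eseriesr => k _; rewrite mulr_suml -sumEFin.
rewrite nneseries_sum // -sumEFin; apply: eq_bigr => j _.
rewrite (nneseries_split 0%N (n j).+1) // add0n [X in (_ + X)%E]eseries0.
  rewrite adde0 big_nat_recr //= big_nat big1 ?add0e.
    by rewrite /g eqxx mulr1.
  by move=> k /andP[_ lt_k]; rewrite /g ltn_eqF // mulr0 mul0r.
by move=> k; rewrite /g => lt_k _; rewrite gtn_eqF // mulr0 mul0r.
Qed.

(** * The geometric instance *)

Section Instance.
Variables (R : realType) (m : nat).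
Hypothesis m_gt0 : (0 < m)%N.

Let N := (2 ^ m)%N.
Let len j := (N ^ j.+1)%N.
(** The probability that the patience is at least [len j]; the cut at [m] gives the last level all
    the remaining mass. *)
Let tail j : R := if (j < m)%N then 2 ^- j else 0.
Let mass j := tail j - tail j.+1.
(** The longest patience is [N ^ m], so no level runs out of vertices. *)
Let vertex : finType := ('I_m * 'I_(N ^ m))%type.

Let N_gt0 : (0 < N)%N. Proof. by rewrite expn_gt0. Qed.

Let len_gt0 j : (0 < len j)%N. Proof. by rewrite expn_gt0 N_gt0. Qed.

Let two_pow_gt0 j : 0 < 2 ^+ j :> R. Proof. by rewrite exprn_gt0. Qed.

Let mass_half j : (j < m)%N -> 1 <= 2 * (mass j * 2 ^+ j).
Proof.
move=> jm; rewrite /mass /tail jm; case: ifP => _.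
  have := two_pow_gt0 j => p0.
  rewrite exprS; suff -> : 2 * ((2 ^- j - (2 * 2 ^+ j)^-1) * 2 ^+ j) = 1 :> R by [].
  by field; rewrite gt_eqF.
by rewrite subr0 mulVf ?gt_eqF // mulr1 ler1n.
Qed.

Let mass_ge0 j : 0 <= mass j.
Proof.
rewrite subr_ge0 /tail; case: (ltnP j.+1 m) => [jm|_].
  by rewrite (ltnW jm) lef_pV2 ?posrE // ler_eXn2l // ltr1n.
by case: ifP => // _; rewrite invr_ge0 ltW.
Qed.

Let mass_tail j : (j <= m)%N -> \sum_(j <= i < m) mass i = tail j.
Proof.
move=> jm; rewrite -[LHS]opprK -sumrN.
under eq_bigr do rewrite opprB.
by rewrite telescope_sumr // /tail ltnn sub0r opprK.
Qed.

Let mass_sum : \sum_(j < m) mass j = 1.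
Proof. by rewrite -(big_mkord predT mass) mass_tail // /tail m_gt0 invr1. Qed.

Let star_weight (u : vertex) : R := 2 ^+ u.1.
Let star_prob (u : vertex) : R := (len u.1)%:R^-1.
Let star_patience k : R := \sum_(j < m) mass j * (k == len j)%:R.

Let star_weight_ge0 u : 0 <= star_weight u.
Proof. exact/ltW/two_pow_gt0. Qed.

Let star_prob_itv u : 0 <= star_prob u <= 1.
Proof.
by rewrite invr_ge0 ler0n invf_le1 ?ler1n ?ltr0n ?len_gt0.
Qed.

Let star_patience_ge0 k : 0 <= star_patience k.
Proof. by apply: sumr_ge0 => j _; rewrite mulr_ge0. Qed.

Let star_patience0 : star_patience 0%N = 0.
Proof. by apply: big1 => j _; rewrite ltn_eqF ?mulr0 ?len_gt0. Qed.

Let star_patience_sum : (\sum_(0 <= k <oo) (star_patience k)%:E = 1)%E.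
Proof.
transitivity (\sum_(0 <= k <oo) (star_patience k * 1)%:E)%E.
  by apply: eq_eseriesr => k _; rewrite mulr1.
rewrite (nneseries_mixture m len (f := fun=> 1)) //.
by under eq_bigr do rewrite mulr1; rewrite mass_sum.
Qed.

Definition geometric_star : star R :=
  Star star_weight_ge0 star_prob_itv star_patience_ge0 star_patience0
    star_patience_sum.

Let I := geometric_star.

(** * Rewards on the instance and the non-clairvoyant upper bound *)

Lemma geometric_rewardE (sigma : nat -> policy R I) :
  expected_reward sigma =
  (\sum_(j < m) mass j * reward_given (sigma (len j)) (len j))%:E.
Proof.
apply: (nneseries_mixture m len (f := fun k => reward_given (sigma k) k)) => //.
by move=> k; exact: reward_given_ge0.
Qed.

(* The times t < N ^ j are those covered by the patience of level j - 1 (no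
   constraint beyond t = 0 if j = 0). There a probe at level j is bounded by
   ignoring the patience altogether; at any later time, the patience still
   lasts with probability at most 2 ^- j. *)
Let early t : R := \sum_(j < m) (t < N ^ j)%:R * (2 ^+ j / (len j)%:R).

(** Level [j] contributes [N ^ j * 2 ^ j / N ^ (j + 1) = 2 ^ j / N], and these add up to
    [(2 ^ m - 1) / N]; hence the choice [N = 2 ^ m]. *)
Let early_sum : \sum_(0 <= t < N ^ m) early t <= 1.
Proof.
rewrite exchange_big /=.
have cnt (j : 'I_m) : \sum_(0 <= t < N ^ m) (t < N ^ j)%:R = (N ^ j)%:R :> R.
  rewrite (big_cat_nat (n := N ^ j)) //=; last by rewrite leq_pexp2l // ltnW.
  rewrite (eq_big_nat _ _ (F2 := fun=> 1)); last by move=> t /andP[_ ->].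
  rewrite [X in _ + X]big_nat [X in _ + X]big1; last first.
    by move=> t /andP[+ _]; rewrite ltnNge => ->.
  by rewrite addr0 sumr_const_nat subn0.
under eq_bigr do rewrite -mulr_suml cnt.
have -> : \sum_(j < m) (N ^ j)%:R * (2 ^+ j / (len j)%:R) =
    N%:R^-1 * \sum_(j < m) 2 ^+ j :> R.
  rewrite mulr_sumr; apply: eq_bigr => j _; rewrite /len expnS natrM.
  by field; rewrite !pnatr_eq0 -!lt0n expn_gt0 N_gt0.
rewrite mulrC ler_pdivrMr ?ltr0n // mul1r natrX.
have geo k : \sum_(j < k) 2 ^+ j = 2 ^+ k - 1 :> R.
  elim: k => [|k IH]; first by rewrite big_ord0 expr0 subrr.
  by rewrite big_ord_recr /= IH exprS; ring.
by rewrite geo; lra.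
Qed.

Let patience_beyond s : \sum_(j < m) mass j * (s < len j)%:R <= 1.
Proof.
rewrite -[leRHS]mass_sum; apply: ler_sum => j _.
by rewrite -[leRHS]mulr1 ler_wpM2l // lern1 leq_b1.
Qed.

(** Every level below [i] has its patience exhausted by time [N ^ i], which leaves mass at most
    [tail i]. *)
Let patience_late (i : 'I_m) s : (N ^ i <= s)%N ->
  (\sum_(j < m) mass j * (s < len j)%:R) * 2 ^+ i <= 1.
Proof.
move=> is_; rewrite -ler_pdivlMr // mul1r.
have -> : 2 ^- i = tail i by rewrite /tail ltn_ord.
rewrite -mass_tail; last exact: ltnW.
rewrite -(big_mkord predT (fun j => mass j * (s < len j)%:R)).
rewrite (big_cat_nat (n := i)) //=; last exact: ltnW.
rewrite big_nat big1 ?add0r => [|j /andP[_ ji]].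
  apply: ler_sum => j _.
  by rewrite -[leRHS]mulr1 ler_wpM2l // lern1 leq_b1.
rewrite ltnNge (leq_trans _ is_) ?mulr0 // /len leq_pexp2l //.
Qed.

(** Here [size h] is the elapsed time. The 1 pays for late probes: one at [u] earns at most
    [prob u], and the rest is reached with probability [1 - prob u]. *)
Lemma rule_value_geometric_le f d (h : seq I) : (N ^ m <= size h + d)%N ->
  \sum_(j < m) mass j * rule_value f (len j - size h) h <=
  1 + \sum_(size h <= t < size h + d) early t.
Proof.
elim: d h => [|d IH] h.
  rewrite addn0 => hm; rewrite big1 ?addr_ge0 ?big_geq //.
  move=> j _; have /eqP -> : (len j - size h)%N == 0%N.
    by rewrite subn_eq0 (leq_trans _ hm) // leq_pexp2l // ltn_ord.
  by rewrite mulr0.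
have early_ge0 t : 0 <= early t.
  by apply: sumr_ge0 => j _; rewrite mulr_ge0 // divr_ge0 // ltW.
move=> hm; case E: (f h) => [u|]; last first.
  rewrite big1 ?addr_ge0 ?sumr_ge0 // => j _.
  by rewrite rule_value_None // mulr0.
set s := size h; have := IH (rcons h u); rewrite size_rcons addSn -addnS.
move=> /(_ hm) {}IH; set S := (S in _ <= 1 + S) in IH.
have S0 : 0 <= S by rewrite sumr_ge0.
rewrite big_ltn; last by rewrite addnS ltnS leq_addr.
rewrite -/S.
(* The probability that the patience allows a probe at time [s], not conditioned on the past. *)
pose T := \sum_(j < m) mass j * (s < len j)%:R.
have -> : \sum_(j < m) mass j * rule_value f (len j - s) h =
    T * (prob u * weight u) + (1 - prob u) *
    \sum_(j < m) mass j * rule_value f (len j - s.+1) (rcons h u).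
  rewrite mulr_suml mulr_sumr -big_split; apply: eq_bigr => j _ /=.
  case: (ltnP s (len j)) => sj.
    by rewrite -(subnSK sj) /= E; ring.
  move: (sj) (leqW sj); rewrite -!subn_eq0 => /eqP -> /eqP -> /=; ring.
have /andP[p0 p1] := prob_itv u.
have step : T * (prob u * weight u) <= prob u + early s.
  case: (ltnP s (N ^ u.1)) => su.
    have pw : prob u * weight u <= early s.
      rewrite /early (bigD1 u.1) //= su mul1r mulrC lerDl.
      by apply: sumr_ge0 => j _; rewrite mulr_ge0 // divr_ge0 // ltW.
    have : T * (prob u * weight u) <= 1 * (prob u * weight u).
      by rewrite ler_wpM2r ?patience_beyond // mulr_ge0 ?weight_ge0.
    by rewrite mul1r; lra.
  have : prob u * (T * weight u) <= prob u * 1.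
    by rewrite ler_wpM2l //; exact: patience_late.
  have := early_ge0 s; rewrite mulrCA mulr1; lra.
have : (1 - prob u) * \sum_(j < m) mass j * rule_value f (len j - s.+1) (rcons h u)
    <= (1 - prob u) * (1 + S) by rewrite ler_wpM2l // subr_ge0.
have : 0 <= prob u * S by rewrite mulr_ge0.
nra.
Qed.

Lemma nonclairvoyant_le2 (pi : policy R I) :
  (expected_reward (fun=> pi) <= 2%:E)%E.
Proof.
rewrite geometric_rewardE lee_fin.
under eq_bigr do rewrite reward_givenE mulr_sumr.
rewrite exchange_big /= -[leRHS]mul1r -[X in X * _](seed_law_sum pi) mulr_suml.
apply: ler_sum => s _; under eq_bigr do rewrite mulrCA.
rewrite -mulr_sumr ler_wpM2l ?seed_law_ge0 //.
have := @rule_value_geometric_le (@probe R I pi s) (N ^ m) [::] (leqnn _).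
under eq_bigr do rewrite subn0.
by move=> /le_trans; apply; rewrite -[leRHS]/(1 + 1) lerD2l early_sum.
Qed.

(** * The clairvoyant lower bound *)

Definition level_rule (j : 'I_m) (h : seq I) : option I :=
  omap (pair j) (insub (size h)).

(** The next vertex has index [size h], larger than all indices in [h], so [guard] never blocks it;
    the value is the weight times the probability of a success in [k] trials. *)
Lemma rule_value_level (j : 'I_m) k (h : seq I) :
  (size h + k <= N ^ m)%N -> (forall v, v \in h -> (v.2 < size h)%N) ->
  rule_value (guard (level_rule j)) k h =
  2 ^+ j * (1 - (1 - (len j)%:R^-1) ^+ k).
Proof.
elim: k h => [|k IH] h; first by rewrite expr0 subrr mulr0.
move=> hk hlt /=; rewrite /guard /level_rule insubT /=.
  by rewrite (leq_trans _ hk) // addnS ltnS leq_addr.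
move=> lt_h; rewrite ifF; last first.
  by apply/negP => /hlt /=; rewrite ltnn.
rewrite -/(guard (level_rule j)) IH.
- by rewrite /star_prob /star_weight /= exprS; ring.
- by rewrite size_rcons addSn -addnS.
move=> v; rewrite size_rcons mem_rcons inE => /orP[/eqP -> //|/hlt].
by move/leqW.
Qed.

(** With [x = 1 / n], Bernoulli gives [(1 + x) ^ n >= 2], while [(1 - x) ^ n * (1 + x) ^ n <= 1]. *)
Lemma failure_le_half n : (0 < n)%N -> (1 - n%:R^-1) ^+ n <= 2^-1 :> R.
Proof.
move=> n0; have n0R : 0 < n%:R :> R by rewrite ltr0n.
set x := n%:R^-1; have x0 : 0 < x by rewrite invr_gt0.
have x1 : x <= 1 by rewrite invf_le1 // ler1n.
have bern k : 1 + k%:R * x <= (1 + x) ^+ k.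
  elim: k => [|k IH]; first by rewrite mul0r addr0.
  rewrite exprS -natr1; have : 0 <= k%:R * x * x by rewrite !mulr_ge0 // ltW.
  have : (1 + x) * (1 + k%:R * x) <= (1 + x) * (1 + x) ^+ k.
    by rewrite ler_wpM2l // addr_ge0 // ltW.
  nra.
have := bern n; rewrite mulfV ?gt_eqF // => two.
have : ((1 - x) * (1 + x)) ^+ n <= 1.
  by rewrite exprn_ile1 //; nra.
rewrite exprMn => le1.
have y0 : 0 <= (1 - x) ^+ n by rewrite exprn_ge0 // subr_ge0.
have : (1 - x) ^+ n * (1 + 1) <= (1 - x) ^+ n * (1 + x) ^+ n by rewrite ler_wpM2l.
lra.
Qed.

Lemma clairvoyant_ge (sigma : nat -> policy R I) :
  (forall k (pi : policy R I),
    reward_given pi k <= reward_given (sigma k) k) ->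
  ((m%:R / 4)%:E <= expected_reward sigma)%E.
Proof.
move=> opt; rewrite geometric_rewardE lee_fin.
have -> : m%:R / 4 = \sum_(j < m) 4^-1 :> R.
  by rewrite sumr_const card_ord mulrC mulr_natr.
apply: ler_sum => j _.
have := opt (len j) (rule_policy (level_rule j)).
rewrite reward_given_rule rule_value_level //; last first.
  by rewrite add0n leq_pexp2l // ltn_ord.
move=> le_r; have := failure_le_half (len_gt0 j).
set y := (1 - _) ^+ _ in le_r *; move=> y_le.
apply: le_trans (ler_wpM2l (mass_ge0 j) le_r).
rewrite mulrA; have := mass_half (ltn_ord j); set t := mass j * _ => t_ge.
(* With [t >= 1/2] and [y <= 1/2], this product makes [t * (1 - y) >= 1/4] linear. *)
have : 0 <= (t - 2^-1) * (2^-1 - y) by rewrite mulr_ge0 // subr_ge0; lra.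
lra.
Qed.

End Instance.

Theorem theorem9 (R : realType) (eps : R) (eps_gt0 : 0 < eps) :
  exists (I : star R) (pi : policy R I) (sigma : nat -> policy R I),
    [/\ optimal_nonclairvoyant pi,
        optimal_clairvoyant sigma,
        (0 < expected_reward sigma)%E &
        (expected_reward (fun=> pi) <= eps%:E * expected_reward sigma)%E].
Proof.
(* Chosen so that [eps * (m / 4)] exceeds the upper bound 2. *)
pose m := (Num.truncn (8 / eps)).+1.
have m0 : (0 < m)%N by [].
have lt_m : 8 / eps < m%:R by exact: truncnS_gt.
have [pi pi_opt] := nonclairvoyant_optimum (geometric_star R m0).
have [sigma sigma_opt] := clairvoyant_pointwise_optimum (geometric_star R m0).
have sigma_ge := clairvoyant_ge sigma_opt.
exists (geometric_star R m0), pi, sigma; split=> //.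
- exact: pointwise_optimal_clairvoyant.
- by apply: lt_le_trans sigma_ge; rewrite lte_fin divr_gt0 // ltr0n.
apply: le_trans (nonclairvoyant_le2 pi) _.
apply: (@le_trans _ _ (eps%:E * (m%:R / 4)%:E)%E); last first.
  by apply: lee_wpmul2l => //; rewrite lee_fin ltW.
rewrite -EFinM lee_fin; move: lt_m; rewrite ltr_pdivrMr // => lt_m.
lra.
Qed.
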